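(* Let $n\ge 0$ and $0\le j\le n$ be integers and let $a,b\ge 0$ be real. The following formulas hold whenever all denominators occurring in them, and in the definitions of the quantities involved, are non-zero. $$e_{n,j}(b,b)=\frac1{n!}\binom{n}{j}(2b+n-1)^{(j)}(b+j)^{(n-j)},\qquad \tilde e_{n,j}(b,b)=(-1)^{n-j}\frac{n!\,(b+j)^{(n-j)}(2b+2j-1)}{(n-j)!\,(2b+j-1)^{(n+1)}},$$ $$e_{n,j}(a,\tfrac12)=\frac{(a-\frac12+n)^{(j)}(\frac12)^{(n)}}{j!(n-j)!\,(\frac12)^{(j)}},\qquad \tilde e_{n,j}(a,\tfrac12)=(-1)^{n-j}\frac{(a-\frac12+2j)\,(\frac12+j)^{(n-j)}\,n!}{(n-j)!\,(a-\frac12+j)^{(n+1)}},$$ $$e_{n,j}(a,\tfrac32)=\frac{(a+\frac12+n)^{(j)}(\frac32)^{(n)}}{j!(n-j)!\,(\frac32)^{(j)}},\qquad \tilde e_{n,j}(a,\tfrac32)=(-1)^{n-j}\frac{(a+\frac12+2j)\,(\frac32+j)^{(n-j)}\,n!}{(n-j)!\,(a+\frac12+j)^{(n+1)}};$$ $$c_{n,j}(a,\tfrac12;b,\tfrac12)=(-1)^{n-j}c_{n,j}(\tfrac12,a;\tfrac12,b)=(-1)^{n-j}\frac{(\frac12)^{(n)}(a-b)^{(n-j)}(a-\frac12+n)^{(j)}(b-\frac12+2j)}{(n-j)!\,(\frac12)^{(j)}(b+\frac12+2j)^{(n-j)}(b-\frac12+j)^{(j+1)}},$$ $$c_{n,j}(a,\tfrac32;b,\tfrac32)=(-1)^{n-j}c_{n,j}(\tfrac32,a;\tfrac32,b)=(-1)^{n-j}\frac{(\frac32)^{(n)}(a-b)^{(n-j)}(a+\frac12+n)^{(j)}(b+\frac12+2j)}{(n-j)!\,(\frac32)^{(j)}(b+\frac32+2j)^{(n-j)}(b+\frac12+j)^{(j+1)}};$$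 $$c_{n,j}(a,b;b,b)=(-1)^{n-j}c_{n,j}(b,a;b,b)=(-1)^{n-j}\frac{(b+j)^{(n-j)}(a-b)^{(n-j)}(a+b+n-1)^{(j)}(2b+2j-1)}{(n-j)!\,(2b+j-1)^{(n+1)}},$$ $$c_{n,j}(b,b;a,b)=(-1)^{n-j}c_{n,j}(b,b;b,a)=(-1)^{n-j}\frac{(b+j)^{(n-j)}(2b+n-1)^{(j)}(b-a)^{(n-j)}(a+b+2j-1)}{(n-j)!\,(a+b+j-1)^{(n+1)}};$$ and $$c_{n,j}(a,a;b,b)=\begin{cases}0,& n-j\text{ odd},\\[4pt] \dfrac{(2b+2j-1)\,(2a+n-1)^{(j)}\,(a-b)^{((n-j)/2)}\,(b+j)^{((n-j)/2)}\,\big(a+\frac{n+j}{2}\big)^{((n-j)/2)}}{\big(\frac{n-j}{2}\big)!\,(2b+j-1)^{(n+1)}},& n-j\text{ even}.\end{cases}$$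
   Context: $(x)^{(n)}=x(x+1)\cdots(x+n-1)$ is the rising factorial, $(x)^{(0)}=1$. For integers $0\le m\le n$ put $$e_{n,m}(a,b)=\frac{1}{n!}\binom{n}{m}(a+b+n-1)^{(m)}(b+m)^{(n-m)},$$ $$\tilde e_{n,m}(a,b)=(-1)^{n-m}\frac{n!\,(b+m)^{(n-m)}}{(n-m)!\,(a+b+m-1)^{(m)}(a+b+2m)^{(n-m)}},$$ and $$c_{n,j}(a,b;c,d)=\sum_{k=j}^{n}e_{n,k}(a,b)\,\tilde e_{k,j}(c,d).$$ The $c_{n,j}(a,b;c,d)$ are the connection coefficients $J_n(x|a,b)=\sum_{j=0}^n c_{n,j}(a,b;c,d)J_j(x|c,d)$ between the Jacobi polynomials $J_n(x|a,b)=\sum_{m=0}^n e_{n,m}(a,b)\,(x-1)^m/2^m$. *)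

(* Defs.v *)
From mathcomp Require Import all_boot all_order all_algebra.
From mathcomp Require Export reals.

Set Implicit Arguments.
Unset Strict Implicit.
Unset Printing Implicit Defensive.

Import GRing.Theory.
Local Open Scope ring_scope.

(* x (x + 1) ... (x + n - 1), with value 1 for n = 0 *)
Definition rfact (R : realType) (x : R) (n : nat) : R :=
  \prod_(i < n) (x + i%:R).

(* In the definitions below, [n - m] is truncated subtraction on [nat]; they
   are meant for [m <= n]. *)

Definition jac_e (R : realType) (n m : nat) (a b : R) : R :=
  (n`!%:R)^-1 * 'C(n, m)%:R * rfact (a + b + n%:R - 1) m
    * rfact (b + m%:R) (n - m).

(* The part of the denominator of [jac_et] that can vanish: the remaining
   factor is (n - m)!. *)
Definition jac_et_den (R : realType) (n m : nat) (a b : R) : R :=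
  rfact (a + b + m%:R - 1) m * rfact (a + b + (2 * m)%:R) (n - m).

Definition jac_et (R : realType) (n m : nat) (a b : R) : R :=
  (-1) ^+ (n - m) *
  ((n`!%:R * rfact (b + m%:R) (n - m)) / ((n - m)`!%:R * jac_et_den n m a b)).

Definition jac_c (R : realType) (n j : nat) (a b c d : R) : R :=
  \sum_(j <= k < n.+1) jac_e n k a b * jac_et k j c d.

(* Division is total (x / 0 = 0 in a field).  This says that no denominator vanishes
   in any of the terms of [jac_c n j a b c d]; it does not depend on a, b. *)
Definition jac_c_defined (R : realType) (n j : nat) (c d : R) : Prop :=
  forall k : nat, (j <= k <= n)%N -> jac_et_den k j c d != 0.

(* Main.v *)
Require Import Defs.
From mathcomp Require Import all_boot all_order all_algebra reals.
From mathcomp Require Import zify ring.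

Set Implicit Arguments.
Unset Strict Implicit.
Unset Printing Implicit Defensive.

Import Order.TTheory GRing.Theory Num.Theory.
Local Open Scope ring_scope.

(** After pulling out the common factors, c_{n,j}(a,b;c,d) is a terminating
3F2 at 1 with n - j + 1 terms. If b = d it collapses to a 2F1, summed by
Chu-Vandermonde; if a = c it is Saalschuetzian, summed by Pfaff-Saalschuetz, and
the two results differ exactly by the sign (-1)^(n-j). For (a,a;b,b) it is the
terminating Watson sum, which satisfies a recurrence relating n and n + 2 with
no term in n + 1, whence the vanishing for n - j odd. Pfaff-Saalschuetz and
Watson are proved by Zeilberger's creative telescoping, with denominators
cleared. *)

(** * Rising factorials and binomial quotients *)

Section RisingFactorial.
Variable R : realType.
Implicit Types x y : R.

Lemma rfact0 x : rfact x 0 = 1.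
Proof. by rewrite /rfact big_ord0. Qed.

Lemma rfactSr x n : rfact x n.+1 = rfact x n * (x + n%:R).
Proof. by rewrite /rfact big_ord_recr. Qed.

Lemma rfactD x m n : rfact x (m + n) = rfact x m * rfact (x + m%:R) n.
Proof.
elim: n => [|n IHn]; first by rewrite addn0 rfact0 mulr1.
by rewrite addnS !rfactSr IHn natrD; ring.
Qed.

Lemma rfact1 x : rfact x 1 = x.
Proof. by rewrite rfactSr rfact0; ring. Qed.

Lemma rfactSl x n : rfact x n.+1 = x * rfact (x + 1) n.
Proof. by rewrite -add1n rfactD rfact1. Qed.

Lemma rfactSlE x y n : x + 1 = y -> rfact x n.+1 = x * rfact y n.
Proof. by move=> <-; rewrite rfactSl. Qed.

Lemma rfact_gt0 x n : 0 < x -> 0 < rfact x n.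
Proof. by move=> x0; apply: prodr_gt0 => i _; rewrite ltr_wpDr. Qed.

(** The factors on the left are those of [rfact x n], negated and in reverse order. *)
Lemma rfact_reflect x n : rfact (1 - x - n%:R) n = (-1) ^+ n * rfact x n.
Proof.
elim: n x => [|n IHn] x; first by rewrite !rfact0; ring.
rewrite rfactSr [in RHS]rfactSl.
have -> : 1 - x - n.+1%:R = 1 - (x + 1) - n%:R by ring.
by rewrite IHn exprS; ring.
Qed.

Lemma binR n k : (k <= n)%N ->
  'C(n, k)%:R = n`!%:R / (k`!%:R * (n - k)`!%:R) :> R.
Proof.
move=> kn; rewrite -(bin_fact kn) !natrM mulfK //.
by rewrite -natrM pnatr_eq0 -lt0n muln_gt0 !fact_gt0.
Qed.

Lemma factR_neq0 n : n`!%:R != 0 :> R.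
Proof. by rewrite pnatr_eq0 -lt0n fact_gt0. Qed.

End RisingFactorial.

(** * Terminating hypergeometric sums at 1 *)

Section Summation.
Variable R : realType.
Implicit Types a b c x z : R.

(** Pascal's rule splits the sum S(n+1; x, z) into (z + n) S(n; x, z) - x S(n; x + 1, z + 1). By
    induction both sums depend on z - x only, hence agree. *)
Lemma chu_vandermonde n x z :
  \sum_(i < n.+1) (-1) ^+ i * 'C(n, i)%:R * rfact x i * rfact (z + i%:R) (n - i)
  = rfact (z - x) n.
Proof.
elim: n x z => [|n IHn] x z.
  by rewrite big_ord1 /= bin0 !rfact0; ring.
rewrite rfactSr -IHn.
transitivity
  ((z + n%:R) *
     \sum_(i < n.+1) (-1) ^+ i * 'C(n, i)%:R * rfact x i
        * rfact (z + i%:R) (n - i)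
   - x * \sum_(i < n.+1) (-1) ^+ i * 'C(n, i)%:R * rfact (x + 1) i
        * rfact (z + 1 + i%:R) (n - i)); last first.
  by rewrite !IHn (_ : z + 1 - (x + 1) = z - x); ring.
(* Written with 'C(n, 0), the term i = 0 completes the 'C(n, i + 1) half of Pascal's rule to a full
   sum, whose top term 'C(n, n + 1) is zero. *)
rewrite big_ord_recl bin0 -(bin0 n).
under eq_bigr => i _ do
  rewrite lift0 subSS binS natrD mulrDr !mulrDl.
rewrite big_split /= addrA; congr (_ + _); last first.
  rewrite mulr_sumr -sumrN; apply: eq_bigr => i _.
  have -> : z + 1 + i%:R = z + i.+1%:R by ring.
  by rewrite exprS rfactSl; ring.
rewrite big_ord_recr /= (bin_small (ltnSn n)) mulr0 !mul0r !addr0.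
rewrite [in RHS]big_ord_recl mulrDr mulr_sumr; congr (_ + _).
  by rewrite /= !bin0 !subn0 rfactSr !rfact0 ?addr0; ring.
apply: eq_bigr => i _; rewrite lift0.
have -> : (n - i = (n - i.+1).+1)%N by have := ltn_ord i; lia.
rewrite !rfactSr natrB ?ltn_ord //; ring.
Qed.

(** The summand of 3F2(-n, a + b + n - 1, c; a, b + c; 1), multiplied by (a)_n (b + c)_n so that it
    is polynomial in a, b, c. *)
Definition saalschutz_term n a b c i :=
  (-1) ^+ i * 'C(n, i)%:R * rfact (a + b + n%:R - 1) i * rfact (a + i%:R) (n - i)
    * rfact c i * rfact (b + c + i%:R) (n - i).

(* The right-hand side is the Wilf-Zeilberger certificate of the recurrence
   F (n + 1) = (b + n) (a - c + n) F n. *)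
Lemma saalschutz_partial_sum n a b c m : (m <= n)%N ->
  \sum_(i < m.+1) (saalschutz_term n.+1 a b c i
                   - (b + n%:R) * (a - c + n%:R) * saalschutz_term n a b c i)
  = (a + b + n%:R *+ 2) *
    ((-1) ^+ m * 'C(n, m)%:R * rfact (a + b + n%:R) m * rfact (a + m%:R) (n - m)
     * rfact c m.+1 * rfact (b + c + m%:R) (n - m)).
Proof.
elim: m => [_|m IHm mn].
  rewrite big_ord1 /saalschutz_term /= !bin0 !subn0 !rfact0 !rfactSr rfact0.
  by rewrite !addr0; ring.
rewrite big_ord_recr IHm /=; last exact: ltnW.
have [l en] : exists l, n = (m + l).+1 by exists (n - m.+1)%N; lia.
have e1 : (n - m = l.+1)%N by lia.
have e2 : (n - m.+1 = l)%N by lia.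
have e3 : (n.+1 - m.+1 = l.+1)%N by lia.
have enR : n%:R = m%:R + l%:R + 1 :> R by rewrite en; ring.
rewrite /saalschutz_term !binR; try lia.
rewrite e1 e2 e3 exprS.
have -> : a + b + n.+1%:R - 1 = a + b + n%:R by ring.
rewrite (rfactSlE (y := a + b + n%:R) (x := a + b + n%:R - 1)); last by ring.
rewrite (rfactSlE (y := a + m.+1%:R) (x := a + m%:R)); last by ring.
rewrite (rfactSlE (y := b + c + m.+1%:R) (x := b + c + m%:R)); last by ring.
rewrite !rfactSr !factS !natrM.
have := factR_neq0 R n; have := factR_neq0 R m; have := factR_neq0 R l.
have : m.+1%:R != 0 :> R by rewrite pnatr_eq0.
have : l.+1%:R != 0 :> R by rewrite pnatr_eq0.
rewrite -![_.+1%:R]natr1 enR.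
(* All terms now share the same four rising factorials; as atoms they leave an identity of rational
   functions. *)
move: (rfact _ _) (rfact _ _) (rfact _ _) (rfact _ _) => u1 u2 u3 u4.
move: ((-1) ^+ m) n`!%:R m`!%:R l`!%:R m%:R l%:R => s N M L p q h1 h2 h3 h4 h5.
by field; rewrite ?h1 ?h2 ?h3 ?h4 ?h5.
Qed.

(** Telescoping up to m = n leaves out only the term i = n + 1 of the sum for n + 1, and that term
    cancels the certificate. *)
Lemma saalschutz n a b c :
  \sum_(i < n.+1) saalschutz_term n a b c i = rfact b n * rfact (a - c) n.
Proof.
elim: n => [|n IHn].
  by rewrite big_ord1 /saalschutz_term /= bin0 !rfact0; ring.
rewrite !rfactSr.
have := saalschutz_partial_sum a b c (leqnn n); rewrite sumrB -mulr_sumr IHn subnn => h.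
rewrite big_ord_recr /=; move/eqP: h; rewrite subr_eq => /eqP ->.
rewrite /saalschutz_term !binn subnn !rfact0 exprS !rfactSr.
have -> : a + b + n.+1%:R - 1 = a + b + n%:R by ring.
by ring.
Qed.

(** The summand of 3F2(-n, 2a + n - 1, b; a, 2b; 1), multiplied by (a)_n (2b)_n. *)
Definition watson_term n a b i :=
  (-1) ^+ i * 'C(n, i)%:R * rfact (2 * a + n%:R - 1) i * rfact (a + i%:R) (n - i)
    * rfact b i * rfact (2 * b + i%:R) (n - i).

(* The certificate of the second-order recurrence [watson_rec]. *)
Lemma watson_partial_sum n a b m : (m <= n)%N ->
  \sum_(i < m.+1) ((2 * a + n%:R) * watson_term n.+2 a b i
     - n.+1%:R * (2 * a - 2 * b + n%:R) * (2 * b + n%:R) * (a + n%:R)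
       * (a + n.+1%:R) * watson_term n a b i)
  = 2 * (2 * a + 2 * n%:R + 1) * (a + n.+1%:R) *
    ((-1) ^+ m * 'C(n.+1, m)%:R * rfact (2 * a + n%:R) m
     * rfact (a + m%:R) (n.+1 - m) * rfact b m.+1
     * rfact (2 * b + m%:R) (n.+1 - m)).
Proof.
elim: m => [_|m IHm mn].
  rewrite big_ord1 /watson_term /= !bin0 !subn0 !rfact0 !rfactSr rfact0.
  by rewrite !addr0; ring.
rewrite big_ord_recr IHm /=; last exact: ltnW.
have [l en] : exists l, n = (m + l).+1 by exists (n - m.+1)%N; lia.
have e2 : (n - m.+1 = l)%N by lia.
have e4 : (n.+1 - m = l.+2)%N by lia.
have e3 : (n.+1 - m.+1 = l.+1)%N by lia.
have e5 : (n.+2 - m.+1 = l.+2)%N by lia.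
have enR : n%:R = m%:R + l%:R + 1 :> R by rewrite en; ring.
(* All four binomials are polynomial multiples of X, so the final identity is polynomial and [ring]
   closes it. *)
pose X : R := n`!%:R / (m.+1`!%:R * l.+2`!%:R).
have nz1 k : 1 + k%:R != 0 :> R by rewrite nat1r pnatr_eq0.
have nz2 k : 2 + k%:R != 0 :> R by rewrite -natrD pnatr_eq0.
have fnz := factR_neq0 R.
have b1 : 'C(n.+2, m.+1)%:R = n.+2%:R * n.+1%:R * X.
  by rewrite binR ?e5; last lia; rewrite /X !factS !natrM; field; rewrite ?nz1 ?nz2 !fnz.
have b2 : 'C(n, m.+1)%:R = l.+2%:R * l.+1%:R * X.
  by rewrite binR ?e2; last lia; rewrite /X !factS !natrM; field; rewrite ?nz1 ?nz2 !fnz.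
have b3 : 'C(n.+1, m.+1)%:R = n.+1%:R * l.+2%:R * X.
  by rewrite binR ?e3; last lia; rewrite /X !factS !natrM; field; rewrite ?nz1 ?nz2 !fnz.
have b4 : 'C(n.+1, m)%:R = n.+1%:R * m.+1%:R * X.
  by rewrite binR ?e4; last lia; rewrite /X !factS !natrM; field; rewrite ?nz1 ?nz2 !fnz.
rewrite /watson_term b1 b2 b3 b4 e2 e3 e4 e5 exprS.
(* The prefactor 2a + n of the recurrence extends the base 2a + n + 1 down to 2a + n, the base used
   in the certificate. *)
have r1 : rfact (2 * a + n.+2%:R - 1) m.+1 * (2 * a + n%:R)
  = rfact (2 * a + n%:R) m * (2 * a + n%:R + m%:R) * (2 * a + n%:R + m.+1%:R).
  rewrite -!rfactSr [in RHS]rfactSl mulrC; congr (_ * rfact _ _); ring.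
rewrite (rfactSlE (y := 2 * a + n%:R) (x := 2 * a + n%:R - 1)); last by ring.
rewrite (rfactSlE (y := a + m.+1%:R) (x := a + m%:R)); last by ring.
rewrite (rfactSlE (y := 2 * b + m.+1%:R) (x := 2 * b + m%:R)); last by ring.
have -> t u v w : (2 * a + n%:R) * (t * rfact (2 * a + n.+2%:R - 1) m.+1 * u * v * w)
  = t * u * v * w * (rfact (2 * a + n%:R) m * (2 * a + n%:R + m%:R) * (2 * a + n%:R + m.+1%:R)).
  by rewrite -r1; ring.
rewrite !rfactSr -![_.+1%:R]natr1 enR.
move: (rfact _ _) (rfact _ _) (rfact _ _) (rfact _ _) => u1 u2 u3 u4.
move: {b1 b2 b3 b4} X ((-1) ^+ m) m%:R l%:R => X s p q; ring.
Qed.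

(** The terms i = n + 1 and i = n + 2 of the upper sum, left out by the telescoping, cancel the
    certificate at m = n. *)
Lemma watson_rec n a b :
  (2 * a + n%:R) * \sum_(i < n.+3) watson_term n.+2 a b i
  = n.+1%:R * (2 * a - 2 * b + n%:R) * (2 * b + n%:R) * (a + n%:R)
      * (a + n.+1%:R) * \sum_(i < n.+1) watson_term n a b i.
Proof.
have := watson_partial_sum a b (leqnn n); rewrite sumrB -!mulr_sumr => h.
rewrite 2!big_ord_recr /= !mulrDr; move/eqP: h; rewrite subr_eq => /eqP ->.
have e1 : (n.+2 - n.+1 = 1)%N by lia.
have e2 : (n.+1 - n = 1)%N by lia.
rewrite /watson_term !binn subnn e1 e2 !rfact0 !rfact1.
have -> : 'C(n.+2, n.+1) = n.+2 by rewrite -bin_sub // e1 bin1.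
have -> : 'C(n.+1, n) = n.+1 by rewrite -bin_sub // e2 bin1.
have r1 k : (2 * a + n%:R) * rfact (2 * a + n.+2%:R - 1) k
  = rfact (2 * a + n%:R) k * (2 * a + n%:R + k%:R).
  rewrite -!rfactSr [in RHS]rfactSl; congr (_ * rfact _ _); ring.
have r2 k t u v w : (2 * a + n%:R) * (t * rfact (2 * a + n.+2%:R - 1) k * u * v * w)
  = t * u * v * w * (rfact (2 * a + n%:R) k * (2 * a + n%:R + k%:R)).
  by rewrite -r1; ring.
rewrite !r2 !exprS !rfactSr; ring.
Qed.

(** For order 1 the two terms are 2ab and -2ab. The recurrence carries zero to all odd orders,
    because a >= 0 makes its left factor positive there. *)
Lemma watson_odd n a b : 0 <= a -> \sum_(i < n.*2.+2) watson_term n.*2.+1 a b i = 0.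
Proof.
move=> a0; elim: n => [|n IHn].
  rewrite double0 big_ord_recl big_ord1 lift0 /watson_term [val ord0]/= subn0 subnn.
  by rewrite /= bin0 binn !rfact0 !rfact1; ring.
have := watson_rec n.*2.+1 a b; rewrite IHn mulr0 => /eqP.
rewrite mulf_eq0 gt_eqF /=; first by move/eqP.
by rewrite ltr_wpDl ?mulr_ge0.
Qed.

Lemma watson_even n a b : 0 <= a ->
  n`!%:R * \sum_(i < n.*2.+1) watson_term n.*2 a b i
  = n.*2`!%:R * (rfact (a - b) n * rfact b n * rfact (a + n%:R) n).
Proof.
(* The factor 2 a of [watson_rec] at n = 0 vanishes when a = 0, so the
   induction starts at n = 1. *)
move=> a0; case: n => [|n].
  by rewrite big_ord1 /watson_term !rfact0 bin0; ring.
elim: n => [|n IHn].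
  rewrite (_ : 1.*2 = 2)%N // 2!big_ord_recl big_ord1 !lift0 /watson_term.
  rewrite /= bin0 bin1 binn !subSS !subn0 !rfactSr !rfact0 !factS fact0; ring.
move: n.+1 (ltn0Sn n) IHn => {}n n_gt0 IHn.
have dn : n.*2%:R = 2 * n%:R :> R by rewrite -mul2n natrM.
have p0 : 2 * a + n.*2%:R != 0.
  by rewrite gt_eqF // ltr_wpDl ?mulr_ge0 // ltr0n double_gt0.
(* Both sides are (a + n)_(n+2). This matches the factors a + 2n and a + 2n + 1 of the recurrence;
   the extra a + n is half of its left factor 2a + 2n. *)
have r : (a + n%:R) * rfact (a + n.+1%:R) n.+1
    = rfact (a + n%:R) n * (a + n.*2%:R) * (a + n.*2.+1%:R).
  have -> : a + n.+1%:R = a + n%:R + 1 by ring.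
  by rewrite -rfactSl !rfactSr -[n.*2.+1%:R]natr1 dn; ring.
apply: (mulfI p0).
transitivity (n.+1%:R * (n.*2.+1%:R * (2 * a - 2 * b + n.*2%:R)
    * (2 * b + n.*2%:R) * (a + n.*2%:R) * (a + n.*2.+1%:R))
    * (n`!%:R * \sum_(i < n.*2.+1) watson_term n.*2 a b i)).
  by rewrite factS natrM doubleS mulrCA watson_rec; ring.
rewrite IHn.
transitivity (2 * n.*2.+2`!%:R * rfact (a - b) n.+1 * rfact b n.+1
    * ((a + n%:R) * rfact (a + n.+1%:R) n.+1)).
  rewrite r !factS !natrM !(rfactSr _ n) -![_.+1%:R]natr1 dn; ring.
rewrite doubleS dn; ring.
Qed.
End Summation.

(** * Closed forms of the coefficients *)

Section Connection.
Variable R : realType.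
Implicit Types a b c d h : R.

Lemma jac_et_denC n j c d : jac_et_den n j c d = jac_et_den n j d c.
Proof. by rewrite /jac_et_den (addrC c). Qed.

(** Relative to c + d, the products in [jac_et_den] cover the shifts j - 1 to 2j - 2 and 2j to n + j
    - 1; the shift 2j - 1 fills the gap. *)
Lemma rfact_jac_et_den n j c d : (j <= n)%N ->
  rfact (c + d + j%:R - 1) n.+1
  = jac_et_den n j c d * (c + d + (2 * j)%:R - 1).
Proof.
move=> jn; have -> : n.+1 = (j.+1 + (n - j))%N by lia.
rewrite rfactD rfactSr /jac_et_den.
have -> : c + d + j%:R - 1 + j.+1%:R = c + d + (2 * j)%:R by ring.
by ring.
Qed.

Lemma jac_et_rfact n j c d : (j <= n)%N ->
  rfact (c + d + j%:R - 1) n.+1 != 0 ->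
  jac_et n j c d =
  (-1) ^+ (n - j) * ((n`!%:R * rfact (d + j%:R) (n - j) * (c + d + (2 * j)%:R - 1))
     / ((n - j)`!%:R * rfact (c + d + j%:R - 1) n.+1)).
Proof.
move=> jn; rewrite rfact_jac_et_den // mulf_eq0 negb_or => /andP[h1 h2].
have h3 := factR_neq0 R (n - j).
rewrite /jac_et; congr (_ * _).
by move: (_ - 1) h2 => y h2; field; rewrite h1 h2 h3.
Qed.

(** For h > 0 the factor (h)_j is non-zero, so (h + j)_(n-j) = (h)_n / (h)_j. Used for h = 1/2 and h
    = 3/2. *)
Lemma jac_e_pos n j a h : (j <= n)%N -> 0 < h ->
  jac_e n j a h = rfact (a + h + n%:R - 1) j * rfact h n
                  / (j`!%:R * (n - j)`!%:R * rfact h j).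
Proof.
move=> jn h0; rewrite /jac_e binR //.
have -> : rfact h n = rfact h j * rfact (h + j%:R) (n - j).
  by rewrite -rfactD subnKC.
have h1 := factR_neq0 R (n - j); have h2 := factR_neq0 R j.
have h3 := factR_neq0 R n; have h4 := lt0r_neq0 (rfact_gt0 j h0).
by field; rewrite h1 h2 h3 h4.
Qed.

(** Put k = j + i. The factorials combine to 'C(n - j, i) / (n - j)!, and [jac_et_den k j c d]
    divides [jac_et_den n j c d] with cofactor the last rising factorial of the summand.
    Non-vanishing at k = n thus gives it for every k. *)
Lemma jac_cE n j a b c d : (j <= n)%N -> jac_et_den n j c d != 0 ->
  jac_c n j a b c d =
  rfact (a + b + n%:R - 1) j / ((n - j)`!%:R * jac_et_den n j c d) *
  \sum_(i < (n - j).+1) (-1) ^+ i * 'C(n - j, i)%:R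
     * rfact (a + b + n%:R - 1 + j%:R) i * rfact (b + j%:R + i%:R) (n - j - i)
     * rfact (d + j%:R) i * rfact (c + d + (2 * j)%:R + i%:R) (n - j - i).
Proof.
move=> jn; rewrite /jac_c -[X in \sum_(X <= _ < _) _]add0n big_addn big_mkord subSn //.
move: (n - j)%N (subnKC jn) => N <- {n jn}; rewrite /jac_et_den addKn => den0.
rewrite mulr_sumr; apply: eq_bigr => -[i /=]; rewrite ltnS => iN _.
rewrite /jac_e /jac_et /jac_et_den addnK (addnC i).
move: (N - i)%N (subnKC iN) den0 => l <- {N iN}.
have -> : (j + (i + l) - (j + i) = l)%N by lia.
rewrite !rfactD !mulf_eq0 !negb_or => /and3P[h1 h2 h3].
rewrite !binR ?leq_add2l ?leq_addr // subnDl addKn.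
have -> : b + (j + i)%:R = b + j%:R + i%:R by ring.
have f0 := factR_neq0 R.
by field; rewrite !f0 h1 h2 h3.
Qed.

(** As d = b, the two rising factorials based on b + j join to (b + j)_(n-j), which is free of i;
    Chu-Vandermonde sums the rest. *)
Lemma jac_c_same_snd n j a b c : (j <= n)%N -> jac_et_den n j c b != 0 ->
  jac_c n j a b c b =
  (-1) ^+ (n - j) * (rfact (b + j%:R) (n - j) * rfact (a - c) (n - j)
     * rfact (a + b + n%:R - 1) j / ((n - j)`!%:R * jac_et_den n j c b)).
Proof.
move=> jn den0; rewrite jac_cE //.
set N := (n - j)%N.
have nE : n%:R = N%:R + j%:R :> R by rewrite -natrD subnK.
under eq_bigr => i _.
  rewrite (_ : _ * rfact _ _ = rfact (b + j%:R) N * ((-1) ^+ i * 'C(N, i)%:R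
     * rfact (a + b + n%:R - 1 + j%:R) i
     * rfact (c + b + (2 * j)%:R + i%:R) (N - i))); last first.
    have -> : rfact (b + j%:R) N
        = rfact (b + j%:R) i * rfact (b + j%:R + i%:R) (N - i).
      by rewrite -rfactD subnKC // -ltnS.
    by ring.
  over.
rewrite -mulr_sumr chu_vandermonde.
(* The sign (-1)^(n-j) arises here, by reflecting the base 1 - (a - c) - N. *)
have -> : c + b + (2 * j)%:R - (a + b + n%:R - 1 + j%:R) = 1 - (a - c) - N%:R.
  by rewrite nE; ring.
by rewrite rfact_reflect; ring.
Qed.

(** The summand is [saalschutz_term] of order n - j with all three parameters shifted by j; the
    shift cancels in a - c. *)
Lemma jac_c_same_fst n j a b c : (j <= n)%N -> jac_et_den n j b c != 0 ->
  jac_c n j b a b c =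
  rfact (b + j%:R) (n - j) * rfact (a - c) (n - j)
     * rfact (a + b + n%:R - 1) j / ((n - j)`!%:R * jac_et_den n j b c).
Proof.
move=> jn den0; rewrite jac_cE //.
have nE : n%:R = (n - j)%:R + j%:R :> R by rewrite -natrD subnK.
under eq_bigr => i _.
  rewrite (_ : _ * rfact _ _ =
    saalschutz_term (n - j) (a + j%:R) (b + j%:R) (c + j%:R) i); last first.
    rewrite /saalschutz_term; congr (_ * rfact _ _ * rfact _ _ * _ * rfact _ _);
      rewrite ?nE; ring.
  over.
rewrite saalschutz [b + a]addrC.
have -> : a + j%:R - (c + j%:R) = a - c by ring.
by ring.
Qed.

(** All four sign relations of the theorem are instances of this one. *)
Lemma jac_c_swap n j a b c : (j <= n)%N -> jac_et_den n j c b != 0 ->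
  jac_c n j a b c b = (-1) ^+ (n - j) * jac_c n j b a b c.
Proof.
by move=> jn den0; rewrite jac_c_same_snd // jac_c_same_fst // jac_et_denC.
Qed.

Lemma jac_c_same_snd_rfact n j a b c : (j <= n)%N ->
  rfact (c + b + j%:R - 1) n.+1 != 0 ->
  jac_c n j a b c b =
  (-1) ^+ (n - j) * ((rfact (b + j%:R) (n - j) * rfact (a - c) (n - j)
     * rfact (a + b + n%:R - 1) j * (c + b + (2 * j)%:R - 1))
     / ((n - j)`!%:R * rfact (c + b + j%:R - 1) n.+1)).
Proof.
move=> jn; rewrite rfact_jac_et_den // mulf_eq0 negb_or => /andP[h1 h2].
have h3 := factR_neq0 R (n - j).
rewrite jac_c_same_snd //; congr (_ * _).
by move: (_ - 1) h2 => y h2; field; rewrite h1 h2 h3.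
Qed.

(** The last factor of [rfact (b + h - 1 + j%:R) j.+1] is b + h - 1 + 2j, which also stands in the
    numerator; the others form the first product of [jac_et_den]. *)
Lemma jac_c_same_snd_pos n j a b h : (j <= n)%N -> 0 < h ->
  rfact (b + h + (2 * j)%:R) (n - j) != 0 ->
  rfact (b + h - 1 + j%:R) j.+1 != 0 ->
  jac_c n j a h b h =
  (-1) ^+ (n - j) *
  ((rfact h n * rfact (a - b) (n - j) * rfact (a + h - 1 + n%:R) j
      * (b + h - 1 + (2 * j)%:R))
   / ((n - j)`!%:R * rfact h j * rfact (b + h + (2 * j)%:R) (n - j)
        * rfact (b + h - 1 + j%:R) j.+1)).
Proof.
move=> jn h0 h1; rewrite rfactSr mulf_eq0 negb_or => /andP[h2].
have -> : b + h - 1 + j%:R + j%:R = b + h - 1 + (2 * j)%:R by ring.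
move=> h3.
have e k x : x + h + k%:R - 1 = x + h - 1 + k%:R by ring.
rewrite jac_c_same_snd //; last by rewrite /jac_et_den e mulf_neq0.
rewrite /jac_et_den !e; congr (_ * _).
have -> : rfact h n = rfact h j * rfact (h + j%:R) (n - j).
  by rewrite -rfactD subnKC.
have h4 := factR_neq0 R (n - j); have h5 := lt0r_neq0 (rfact_gt0 j h0).
by move: (b + h - 1 + _) h3 => y h3; field; rewrite h1 h2 h3 h4 h5.
Qed.

Lemma jac_c_diagE n j a b : (j <= n)%N -> jac_et_den n j b b != 0 ->
  jac_c n j a a b b =
  rfact (2 * a + n%:R - 1) j / ((n - j)`!%:R * jac_et_den n j b b) *
  \sum_(i < (n - j).+1) watson_term (n - j) (a + j%:R) (b + j%:R) i.
Proof.
move=> jn den0; rewrite jac_cE //.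
have nE : n%:R = (n - j)%:R + j%:R :> R by rewrite -natrD subnK.
congr (rfact _ _ / _ * _); first by ring.
apply: eq_bigr => i _.
rewrite /watson_term; congr (_ * rfact _ _ * rfact _ _ * _ * rfact _ _);
  rewrite ?nE; ring.
Qed.

Lemma jac_c_diag_odd n j a b : (j <= n)%N -> 0 <= a ->
  jac_et_den n j b b != 0 -> odd (n - j) -> jac_c n j a a b b = 0.
Proof.
move=> jn a0 den0 oddN; rewrite jac_c_diagE //.
rewrite -[(n - j)%N]odd_double_half oddN add1n.
by rewrite watson_odd ?mulr0 // addr_ge0.
Qed.

Lemma jac_c_diag_even n j a b : (j <= n)%N -> 0 <= a -> ~~ odd (n - j) ->
  rfact (2 * b + j%:R - 1) n.+1 != 0 ->
  jac_c n j a a b b =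
    ((2 * b + (2 * j)%:R - 1) * rfact (2 * a + n%:R - 1) j
       * rfact (a - b) (n - j)./2 * rfact (b + j%:R) (n - j)./2
       * rfact (a + (n + j)%:R / 2) (n - j)./2)
    / ((n - j)./2`!%:R * rfact (2 * b + j%:R - 1) n.+1).
Proof.
move=> jn a0 evenN.
have -> : 2 * b = b + b by ring.
rewrite rfact_jac_et_den // mulf_eq0 negb_or => /andP[h1 h2].
rewrite jac_c_diagE //.
have := odd_double_half (n - j); rewrite (negbTE evenN) add0n.
move: (n - j)./2 => M NE; rewrite -NE.
have := watson_even M (b + j%:R) (addr_ge0 a0 (ler0n R j)).
have -> : a + j%:R - (b + j%:R) = a - b by ring.
(* Since n = j + 2M, j + M is the mean of n and j. *)
have -> : a + j%:R + M%:R = a + (n + j)%:R / 2.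
  by rewrite -(subnK jn) -NE -muln2; field.
have h3 := factR_neq0 R M.
(* The value of the sum contains (2M)! / M!, and (2M)! = (n - j)! cancels against the prefactor. *)
move=> /(canRL (mulKf h3)) ->.
have h4 := factR_neq0 R M.*2.
by move: (_ - 1) h2 => y h2; field; rewrite h1 h2 h3 h4.
Qed.
End Connection.

(** * Specialization to the stated parameters *)

Theorem proposition2 (R : realType) (n j : nat) (a b : R)
    (hjn : (j <= n)%N) (ha : 0 <= a) (hb : 0 <= b) :
  (* a = b *)
  (jac_e n j b b =
     (n`!%:R)^-1 * 'C(n, j)%:R * rfact (2 * b + n%:R - 1) j
       * rfact (b + j%:R) (n - j))
  /\
  (jac_et_den n j b b != 0 ->
   rfact (2 * b + j%:R - 1) n.+1 != 0 ->
   jac_et n j b b =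
     (-1) ^+ (n - j) *
     ((n`!%:R * rfact (b + j%:R) (n - j) * (2 * b + (2 * j)%:R - 1))
      / ((n - j)`!%:R * rfact (2 * b + j%:R - 1) n.+1)))
  /\
  (* second parameter 1/2 *)
  (jac_e n j a (1 / 2) =
     (rfact (a - 1 / 2 + n%:R) j * rfact (1 / 2) n)
     / (j`!%:R * (n - j)`!%:R * rfact (1 / 2) j))
  /\
  (jac_et_den n j a (1 / 2) != 0 ->
   rfact (a - 1 / 2 + j%:R) n.+1 != 0 ->
   jac_et n j a (1 / 2) =
     (-1) ^+ (n - j) *
     (((a - 1 / 2 + (2 * j)%:R) * rfact (1 / 2 + j%:R) (n - j) * n`!%:R)
      / ((n - j)`!%:R * rfact (a - 1 / 2 + j%:R) n.+1)))
  /\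
  (* second parameter 3/2 *)
  (jac_e n j a (3 / 2) =
     (rfact (a + 1 / 2 + n%:R) j * rfact (3 / 2) n)
     / (j`!%:R * (n - j)`!%:R * rfact (3 / 2) j))
  /\
  (jac_et_den n j a (3 / 2) != 0 ->
   rfact (a + 1 / 2 + j%:R) n.+1 != 0 ->
   jac_et n j a (3 / 2) =
     (-1) ^+ (n - j) *
     (((a + 1 / 2 + (2 * j)%:R) * rfact (3 / 2 + j%:R) (n - j) * n`!%:R)
      / ((n - j)`!%:R * rfact (a + 1 / 2 + j%:R) n.+1)))
  /\
  (* c(a, 1/2; b, 1/2) *)
  (jac_c_defined n j b (1 / 2) ->
   jac_c_defined n j (1 / 2) b ->
   jac_c n j a (1 / 2) b (1 / 2) =
     (-1) ^+ (n - j) * jac_c n j (1 / 2) a (1 / 2) b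
   /\
   (rfact (b + 1 / 2 + (2 * j)%:R) (n - j) != 0 ->
    rfact (b - 1 / 2 + j%:R) j.+1 != 0 ->
    jac_c n j a (1 / 2) b (1 / 2) =
      (-1) ^+ (n - j) *
      ((rfact (1 / 2) n * rfact (a - b) (n - j) * rfact (a - 1 / 2 + n%:R) j
          * (b - 1 / 2 + (2 * j)%:R))
       / ((n - j)`!%:R * rfact (1 / 2) j
            * rfact (b + 1 / 2 + (2 * j)%:R) (n - j)
            * rfact (b - 1 / 2 + j%:R) j.+1))))
  /\
  (* c(a, 3/2; b, 3/2) *)
  (jac_c_defined n j b (3 / 2) ->
   jac_c_defined n j (3 / 2) b ->
   jac_c n j a (3 / 2) b (3 / 2) =
     (-1) ^+ (n - j) * jac_c n j (3 / 2) a (3 / 2) b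
   /\
   (rfact (b + 3 / 2 + (2 * j)%:R) (n - j) != 0 ->
    rfact (b + 1 / 2 + j%:R) j.+1 != 0 ->
    jac_c n j a (3 / 2) b (3 / 2) =
      (-1) ^+ (n - j) *
      ((rfact (3 / 2) n * rfact (a - b) (n - j) * rfact (a + 1 / 2 + n%:R) j
          * (b + 1 / 2 + (2 * j)%:R))
       / ((n - j)`!%:R * rfact (3 / 2) j
            * rfact (b + 3 / 2 + (2 * j)%:R) (n - j)
            * rfact (b + 1 / 2 + j%:R) j.+1))))
  /\
  (* c(a, b; b, b) *)
  (jac_c_defined n j b b ->
   jac_c n j a b b b = (-1) ^+ (n - j) * jac_c n j b a b b
   /\
   (rfact (2 * b + j%:R - 1) n.+1 != 0 ->
    jac_c n j a b b b =
      (-1) ^+ (n - j) *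
      ((rfact (b + j%:R) (n - j) * rfact (a - b) (n - j)
          * rfact (a + b + n%:R - 1) j * (2 * b + (2 * j)%:R - 1))
       / ((n - j)`!%:R * rfact (2 * b + j%:R - 1) n.+1))))
  /\
  (* c(b, b; a, b) *)
  (jac_c_defined n j a b ->
   jac_c_defined n j b a ->
   jac_c n j b b a b = (-1) ^+ (n - j) * jac_c n j b b b a
   /\
   (rfact (a + b + j%:R - 1) n.+1 != 0 ->
    jac_c n j b b a b =
      (-1) ^+ (n - j) *
      ((rfact (b + j%:R) (n - j) * rfact (2 * b + n%:R - 1) j
          * rfact (b - a) (n - j) * (a + b + (2 * j)%:R - 1))
       / ((n - j)`!%:R * rfact (a + b + j%:R - 1) n.+1))))
  /\
  (* c(a, a; b, b) *)
  (jac_c_defined n j b b ->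
   (odd (n - j) -> jac_c n j a a b b = 0)
   /\
   (~~ odd (n - j) ->
    rfact (2 * b + j%:R - 1) n.+1 != 0 ->
    jac_c n j a a b b =
      ((2 * b + (2 * j)%:R - 1) * rfact (2 * a + n%:R - 1) j
         * rfact (a - b) (n - j)./2 * rfact (b + j%:R) (n - j)./2
         * rfact (a + (n + j)%:R / 2) (n - j)./2)
      / ((n - j)./2`!%:R * rfact (2 * b + j%:R - 1) n.+1))).
Proof.
have half0 : 0 < 1 / 2 :> R by rewrite divr_gt0.
have half3 : 0 < 3 / 2 :> R by rewrite divr_gt0.
(* Selects the instance k = n of [jac_c_defined], whose denominator is a multiple of all the
   others. *)
have jnn : (j <= n <= n)%N by rewrite hjn leqnn.
have two (x : R) : 2 * x = x + x by ring.
(* With h = 1/2 or h = 3/2, both families take the common form x + h - 1. *)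
have half1E (x : R) : x - 1 / 2 = x + 1 / 2 - 1 by field.
have half3E (x : R) : x + 1 / 2 = x + 3 / 2 - 1 by field.
have numC (x y z : R) : x + y - z = x - z + y :> R by ring.
split; first by rewrite /jac_e two.
split.
  by move=> _; rewrite two; exact: jac_et_rfact.
split; first by rewrite jac_e_pos // half1E numC.
split.
  move=> _; rewrite half1E -!numC => den0.
  by rewrite jac_et_rfact //; congr (_ * (_ / _)); ring.
split; first by rewrite jac_e_pos // half3E numC.
split.
  move=> _; rewrite half3E -!numC => den0.
  by rewrite jac_et_rfact //; congr (_ * (_ / _)); ring.
split.
  move=> /(_ _ jnn) den0 _; split; first exact: jac_c_swap.
  by rewrite !half1E; exact: jac_c_same_snd_pos.
split.
  move=> /(_ _ jnn) den0 _; split; first exact: jac_c_swap.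
  by rewrite !half3E; exact: jac_c_same_snd_pos.
split.
  move=> /(_ _ jnn) den0; split; first exact: jac_c_swap.
  by rewrite two; exact: jac_c_same_snd_rfact.
split.
  move=> /(_ _ jnn) den0 _; split; first exact: jac_c_swap.
  move=> rf0; rewrite jac_c_same_snd_rfact // two.
  by congr (_ * (_ / _)); ring.
move=> /(_ _ jnn) den0; split; first exact: jac_c_diag_odd.
exact: jac_c_diag_even.
Qed.
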